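(* For any Hausdorff space $X$, $aL(X)\leq aL'(X)\leq aL_c(X)\leq L(X)$.
   Context: An open ultrafilter on a Hausdorff space $X$ is a maximal filter in the family of open subsets of $X$ (its members are nonempty open sets); it converges to $x\in X$ if it contains every open set containing $x$. $EX$ is the set of all convergent open ultrafilters on $X$. A section is a function $b:X\to EX$ such that $b(x)$ converges to $x$ for every $x\in X$. For a section $b$ and an open set $U$ let $\widehat{U}_b=\{x\in X: U\in b(x)\}$, and for $A\subseteq X$ let $c_b(A)=\{x\in X:\widehat{U}_b\cap A\neq\varnothing\text{ for every open }U\ni x\}$. $A$ is $c_b$-closed if $c_b(A)=A$. For $A\subseteq X$, $aL(A,X)$ is the least infinite cardinal $\kappa$ such that every cover $\mathcal V$ of $A$ by open sets of $X$ has a subfamily $\mathcal W$ with $|\mathcal W|\leq\kappa$ and $A\subseteq\bigcup_{W\in\mathcal W}cl\,W$. Put $aL(X)=aL(X,X)$; $aL_c(X)=\sup\{aL(C,X): C\text{ closed in }X\}+\aleph_0$; $aL^b(X)=\sup\{aL(C,X): C\text{ is }c_b\text{-closed}\}+\aleph_0$; and $aL'(X)=\min\{aL^b(X): b\text{ a section}\}$. $L(X)$ is the Lindelöf degree: the least infinite cardinal $\kappa$ such that every open cover of $X$ has a subcover of size at most $\kappa$. *)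

(* Defs.v *)
From mathcomp Require Import all_boot all_classical all_analysis.

Set Implicit Arguments.
Unset Strict Implicit.
Unset Printing Implicit Defensive.

Local Open Scope classical_set_scope.
Local Open Scope card_scope.

(** A cardinal is represented by a type [K] of that cardinality: order and
    equality of cardinals are [#<=] and [#=] between full sets, so statements
    about cardinals are invariant under the choice of representatives. *)
Definition cardinal_le (K K' : Type) : Prop := [set: K] #<= [set: K'].
Definition cardinal_eq (K K' : Type) : Prop := [set: K] #= [set: K'].

Definition is_least_cardinal (P : Type -> Prop) (K : Type) : Prop :=
  P K /\ forall K' : Type, P K' -> cardinal_le K K'.

Lemma cardinal_leP (T U : Type) :
  cardinal_le T U <-> exists f : T -> U, injective f.
Proof.
split=> [/card_leP[f]|[f fI]].
  have inT (V : Type) (v : V) : v \in [set: V] by rewrite inE.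
  exists (fun x => val (f (SigSub (inT T x)))) => x y /val_inj.
  by move=> /(@inj _ _ _ f); rewrite !inE => /(_ I I)/(congr1 val).
apply: (@card_le_trans _ _ _ (f @` [set: T])).
  suff /card_eqPle[_ ] : f @` [set: T] #= [set: T] by [].
  by apply: inj_card_eq => x y _ _; apply: fI.
exact: card_leT.
Qed.

Lemma cardinal_le_family_least (I : Type) (F : I -> Type) (i0 : I) :
  exists i, forall j, cardinal_le (F i) (F j).
Proof.
pose P := [set S : set (forall i, F i) |
  forall i s t, S s -> S t -> s i = t i -> s = t].
have [|S [PS maxS]] := @Zorn_bigcup _ P.
  move=> C CP totC i s t [A CA As] [B CB Bt].
  have [AB|BA] := totC _ _ CA CB.
    by apply: (CP _ CB i) => //; apply: AB.
  by apply: (CP _ CA i) => //; apply: BA.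
have [[i iS]|noS] := pselect (exists i, forall y : F i, exists s, S s /\ s i = y).
  have {iS}[g gP] := choice iS.
  exists i => j; apply/cardinal_leP; exists (fun y => g y j) => x y gxy.
  have [[Sx <-] [Sy <-]] := (gP x, gP y).
  by rewrite (PS j _ _ Sx Sy gxy).
have {}noS i : exists y : F i, forall s, S s -> s i <> y.
  apply: contrapT => no; apply: noS; exists i => y.
  apply: contrapT => noy; apply: no; exists y => s Ss sy.
  by apply: noy; exists s.
pose t i := sval (cid (noS i)).
have tS i s : S s -> s i <> t i by rewrite /t; case: cid => /= y; apply.
exfalso; apply: (maxS (S `|` [set t])).
  split; first exact: subsetUl.
  by move=> /(_ t (or_intror erefl)) /(tS i0).
move=> i s u [Ss|->] [Su|->] //; first exact: PS.
- by move=> /(tS _ _ Ss).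
- by move=> /esym /(tS _ _ Su).
Qed.

(** Cardinals are well ordered, so the choice below is a genuine one as soon as
    [P] is inhabited. *)
Lemma exists_least_cardinal (P : Type -> Prop) :
  (exists K, P K) -> exists K, is_least_cardinal P K.
Proof.
move=> [K0 PK0].
pose I := {A : set K0 | exists K, P K /\ cardinal_eq K {x | A x}}.
have cTP : cardinal_eq K0 {x | [set: K0] x}.
  apply/card_eqPle; split; apply/cardinal_leP.
    by exists (fun x => exist _ x Logic.I) => x y [].
  by exists sval => -[x []] [y []] /= ->.
pose i0 : I := exist _ [set: K0] (ex_intro _ K0 (conj PK0 cTP)).
have [[A [K [PK KA]]] /= minA] :=
  @cardinal_le_family_least I (fun i => {x | sval i x}) i0.
move: KA => /card_eqPle[KA AK].
exists K; split=> // K' PK'.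
have [b Hb] := @cardinal_le_family_least bool (fun b => if b then K0 else K') true.
case: b Hb => Hb.
  apply: card_le_trans (Hb false); apply: card_le_trans KA _.
  by apply/cardinal_leP; exists sval; apply: eq_sig_hprop.
have /cardinal_leP[f fI] := Hb true.
have fK : cardinal_eq K' {x | range f x}.
  apply/card_eqPle; split; apply/cardinal_leP.
    exists (fun x => exist _ (f x) (ex_intro2 _ _ x Logic.I erefl)) => x y.
    by move=> [/fI].
  have fV (z : {x | range f x}) : exists y, f y = sval z.
    by case: z => z /= [y _ <-]; exists y.
  have [g gP] := choice fV; exists g => x y gxy; apply: eq_sig_hprop => //=.
  by rewrite -!gP gxy.
have /= := minA (exist _ (range f) (ex_intro _ K' (conj PK' fK))).
move: fK => /card_eqPle[_ fK] Af.
by apply: card_le_trans KA (card_le_trans Af fK).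
Qed.

(** The value [void] is only taken when no cardinal satisfies [P]. *)
Definition least_cardinal (P : Type -> Prop) : Type :=
  match pselect (exists K, is_least_cardinal P K) with
  | left exK => projT1 (cid exK)
  | right _ => void
  end.

Lemma least_cardinalP (P : Type -> Prop) :
  (exists K, P K) -> is_least_cardinal P (least_cardinal P).
Proof.
move=> /exists_least_cardinal exK; rewrite /least_cardinal.
by case: pselect => // ?; case: cid.
Qed.

(** Supremum and minimum of the cardinals [F i], [i] in [D]. *)
Definition cardinal_sup (I : Type) (D : set I) (F : I -> Type) : Type :=
  least_cardinal (fun K => forall i, D i -> cardinal_le (F i) K).

Definition cardinal_min (I : Type) (D : set I) (F : I -> Type) : Type :=
  least_cardinal (fun K => exists2 i, D i & cardinal_eq K (F i)).

Section OpenUltrafilters.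
Variable X : topologicalType.

Record open_filter (F : set (set X)) : Prop := OpenFilter {
  open_filter_open : forall U, F U -> open U;
  open_filter_nonempty : forall U, F U -> U !=set0;
  open_filterT : F [set: X];
  open_filterI : forall U V, F U -> F V -> F (U `&` V);
  open_filterS : forall U V, F U -> open V -> U `<=` V -> F V }.

Definition open_ultrafilter (F : set (set X)) : Prop :=
  open_filter F /\ forall G, open_filter G -> F `<=` G -> G = F.

Definition open_converges (F : set (set X)) (x : X) : Prop :=
  forall U, open U -> U x -> F U.

Definition EX : Type :=
  {F : set (set X) | open_ultrafilter F /\ exists x, open_converges F x}.

Definition is_section (b : X -> EX) : Prop :=
  forall x, open_converges (sval (b x)) x.

Definition open_hat (b : X -> EX) (U : set X) : set X :=
  [set x | sval (b x) U].

Definition cb (b : X -> EX) (A : set X) : set X :=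
  [set x | forall U, open U -> U x -> open_hat b U `&` A !=set0].

Definition cb_closed (b : X -> EX) (A : set X) : Prop := cb b A = A.

End OpenUltrafilters.

Section CardinalFunctions.
Variable X : topologicalType.

Definition open_cover (A : set X) (V : set (set X)) : Prop :=
  V `<=` open /\ A `<=` \bigcup_(U in V) U.

(** [aL A] is aL(A, X); the ambient space is the type of the points of [A]. *)
Definition aL (A : set X) : Type :=
  least_cardinal (fun K => infinite_set [set: K] /\
    forall V, open_cover A V ->
      exists W : set (set X), [/\ W `<=` V, W #<= [set: K]
        & A `<=` \bigcup_(U in W) closure U]).

Definition aL_c : Type := (cardinal_sup (@closed X) aL + nat)%type.

Definition aL_b (b : X -> EX X) : Type :=
  (cardinal_sup (cb_closed b) aL + nat)%type.

Definition aL' : Type := cardinal_min (@is_section X) aL_b.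

Definition lindelof_degree : Type :=
  least_cardinal (fun K => infinite_set [set: K] /\
    forall V, open_cover [set: X] V ->
      exists W : set (set X), [/\ W `<=` V, W #<= [set: K]
        & [set: X] `<=` \bigcup_(U in W) U]).

End CardinalFunctions.

(* Main.v *)
Require Import Defs.
From mathcomp Require Import all_boot all_classical all_analysis.
Local Open Scope classical_set_scope.
Local Open Scope card_scope.

(** Convergence of [b x] to [x] gives [U `<=` open_hat b U], so
    [closure A `<=` cb b A] and every [cb]-closed set is closed, while the whole
    space is [cb]-closed; this compares the three suprema defining [aL], [aL']
    and [aL_c].  The last inequality is the usual one: a cover of a closed set
    [C] becomes a cover of the space when [~` C] is added. *)

Lemma cardinal_le_trans (K L M : Type) :
  cardinal_le K L -> cardinal_le L M -> cardinal_le K M.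
Proof. exact: card_le_trans. Qed.

Lemma cardinal_le_inl (K L : Type) : cardinal_le K (K + L).
Proof. by apply/cardinal_leP; exists inl => x y []. Qed.

Lemma cardinal_le_add2r (K L M : Type) :
  cardinal_le K L -> cardinal_le (K + M) (L + M).
Proof.
move=> /cardinal_leP[f fI]; apply/cardinal_leP.
exists (fun z => match z with inl x => inl (f x) | inr m => inr m end).
by move=> [x|m] [y|n] // [] => [/fI|] ->.
Qed.

(* Hilbert's hotel along an injection [g : nat -> K]. *)
Lemma cardinal_le_add_nat (K : Type) :
  infinite_set [set: K] -> cardinal_le (K + nat) K.
Proof.
move=> /infiniteP /cardinal_leP[g gI]; apply/cardinal_leP.
(* [h] sends [g n] to [g n.*2] and fixes everything off the range of [g]; the odd-indexed points
   [g n.*2.+1] are left free to receive [nat]. *)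
have /choice[h hP] (x : K) : exists y,
    (exists2 n, x = g n & y = g n.*2) \/ (~ range g x /\ y = x).
  have [[n _ <-]|xg] := pselect (range g x); last by exists x; right.
  by exists (g n.*2); left; exists n.
have h_odd x n : h x <> g n.*2.+1.
  have [[m _ ->]|[xg ->] xgn] := hP x.
    by move=> /gI/(congr1 odd); rewrite /= !odd_double.
  by apply: xg; exists n.*2.+1.
have hI : injective h.
  move=> x y; have [[m -> ->]|[xg ->]] := hP x;
    have [[n -> ->]|[yg ->]] := hP y => //.
  - by move=> /gI/double_inj ->.
  - by move=> ygm; exfalso; apply: yg; exists m.*2.
  - by move=> xgn; exfalso; apply: xg; exists n.*2.
exists (fun z => match z with inl x => h x | inr n => g n.*2.+1 end).
move=> [x|m] [y|n].
- by move=> /hI ->.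
- by move=> /h_odd.
- by move=> /esym /h_odd.
- by move=> /gI [] /double_inj ->.
Qed.

(** The disjoint sum [{i & F i}] bounds every [F i], so the supremum is never the default value
    [void]. *)
Lemma cardinal_supP (I : Type) (D : set I) (F : I -> Type) :
  is_least_cardinal (fun K => forall i, D i -> cardinal_le (F i) K)
    (cardinal_sup D F).
Proof.
apply: least_cardinalP; exists {i & F i} => i _; apply/cardinal_leP.
(* [{classic I}] gives [I] a decidable equality, which makes [existT F i] injective. *)
by exists (existT F i) => x y; apply: (@existT_inj2 {classic I}).
Qed.

Lemma cardinal_sup_ub (I : Type) (D : set I) (F : I -> Type) (i : I) :
  D i -> cardinal_le (F i) (cardinal_sup D F).
Proof. by have [ub _] := cardinal_supP I D F; apply: ub. Qed.

Lemma cardinal_sup_le (I : Type) (D : set I) (F : I -> Type) (K : Type) :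
  (forall i, D i -> cardinal_le (F i) K) -> cardinal_le (cardinal_sup D F) K.
Proof. by have [_ lub] := cardinal_supP I D F; apply: lub. Qed.

Lemma cardinal_minP (I : Type) (D : set I) (F : I -> Type) : D !=set0 ->
  is_least_cardinal (fun K => exists2 i, D i & cardinal_eq K (F i))
    (cardinal_min D F).
Proof.
move=> [i Di]; apply: least_cardinalP; exists (F i), i => //.
exact: card_eqxx.
Qed.

Section Sections.
Variable X : topologicalType.

(** Zorn's lemma: the union of a chain of open filters is an open filter, two of its members lying
    in a common filter of the chain. *)
Lemma open_filter_extend (F : set (set X)) : open_filter F ->
  exists G, open_ultrafilter G /\ F `<=` G.
Proof.
move=> oF.
(* [Zorn_bigcup] also needs an upper bound of the empty chain, hence [set0]. *)
pose P := [set G : set (set X) | G = set0 \/ (open_filter G /\ F `<=` G)].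
have [C CP totC|G [PG maxG]] := @Zorn_bigcup _ P.
  have [[G0 CG0 [V0 GV0]]|C0] := pselect (exists2 G, C G & G !=set0); last first.
    left; rewrite -subset0 => U [G CG GU]; apply: C0.
    by exists G => //; exists U.
  have Cof G U : C G -> G U -> open_filter G /\ F `<=` G.
    by move=> CG GU; case: (CP _ CG) => // G0E; rewrite G0E in GU.
  have [oG0 FG0] := Cof _ _ CG0 GV0.
  right; split; last by move=> U /FG0 G0U; exists G0.
  split.
  - by move=> U [G CG GU]; have [oG _] := Cof _ _ CG GU; apply: open_filter_open GU.
  - by move=> U [G CG GU]; have [oG _] := Cof _ _ CG GU; apply: open_filter_nonempty GU.
  - by exists G0 => //; apply: open_filterT.
  - move=> U V [G CG GU] [H CH HV].
    have [[oG _] [oH _]] := (Cof _ _ CG GU, Cof _ _ CH HV).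
    have [GH|HG] := totC _ _ CG CH.
      by exists H => //; apply: open_filterI => //; apply: GH.
    by exists G => //; apply: open_filterI => //; apply: HG.
  - move=> U V [G CG GU] oV UV; have [oG _] := Cof _ _ CG GU.
    by exists G => //; apply: open_filterS oV UV.
have FT := open_filterT oF.
have {PG}[oG FG] : open_filter G /\ F `<=` G.
  (* The empty family is not maximal, since [F] contains [[set: X]] and so lies strictly above
     it. *)
  case: PG => // G0; exfalso; apply: (maxG F); last by right; split.
  by rewrite G0; split=> // /(_ _ FT).
exists G; split=> //; split=> // H oH GH; apply: contrapT => HG.
apply: (maxG H); last by right; split=> // U /FG /GH.
by split=> // HG'; apply: HG; apply/seteqP; split.
Qed.

(** Ensures that the minimum [aL'] ranges over a nonempty family. The open sets containing [x] form
    an open filter, and any ultrafilter extending it converges to [x]. *)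
Lemma exists_section : @is_section X !=set0.
Proof.
suff /choice[b bP] (x : X) : exists e : EX X, open_converges (sval e) x.
  by exists b.
have oN : open_filter [set U | open U /\ U x].
  split=> [U []//|U [_ Ux]|| |]; first by exists x.
  - by split=> //; apply: openT.
  - by move=> U V [oU Ux] [oV Vx]; split; [apply: openI|].
  - by move=> U V [oU Ux] oV UV; split=> //; apply: UV.
have [G [uG NG]] := open_filter_extend _ oN.
have Gx : open_converges G x by move=> U oU Ux; apply: NG.
by exists (exist _ G (conj uG (ex_intro _ x Gx))).
Qed.

Variable b : X -> EX X.
Hypothesis b_section : is_section b.

Lemma closure_sub_cb (A : set X) : closure A `<=` cb b A.
Proof.
move=> x clAx U oU Ux.
have [y [Ay Uy]] := clAx U (open_nbhs_nbhs (conj oU Ux)).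
by exists y; split=> //; apply: b_section.
Qed.

Lemma cb_closed_closed (A : set X) : cb_closed b A -> closed A.
Proof. by move=> bA x /closure_sub_cb; rewrite bA. Qed.

Lemma cb_closedT : cb_closed b [set: X].
Proof.
by apply/seteqP; split=> // x _; apply: closure_sub_cb; apply: subset_closure.
Qed.

Lemma aL_le_aL_b : cardinal_le (aL [set: X]) (aL_b b).
Proof.
apply: cardinal_le_trans (cardinal_le_inl _ _).
exact: cardinal_sup_ub cb_closedT.
Qed.

Lemma aL_b_le_aL_c : cardinal_le (aL_b b) (aL_c X).
Proof.
apply: cardinal_le_add2r; apply: cardinal_sup_le => A /cb_closed_closed.
exact: cardinal_sup_ub.
Qed.

End Sections.

Section Lindelof.
Variable X : topologicalType.

Lemma lindelof_degreeP :
  infinite_set [set: lindelof_degree X] /\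
    forall V, open_cover [set: X] V ->
      exists W : set (set X), [/\ W `<=` V, W #<= [set: lindelof_degree X]
        & [set: X] `<=` \bigcup_(U in W) U].
Proof.
pose P (K : Type) := infinite_set [set: K] /\
  forall V, open_cover [set: X] V ->
    exists W : set (set X), [/\ W `<=` V, W #<= [set: K]
      & [set: X] `<=` \bigcup_(U in W) U].
suff exP : exists K, P K by have [] := @least_cardinalP P exP.
(* Every cover, being a set of subsets of [X], has size at most that of [set X]; the summand [nat]
   makes the bound infinite. *)
exists (set X + nat)%type; split.
  by apply/infiniteP/cardinal_leP; exists inr => m n [].
move=> V [_ covV]; exists V; split=> //.
exact: card_le_trans (card_leT V) (cardinal_le_inl _ _).
Qed.

Lemma aL_closed_le (C : set X) : closed C -> cardinal_le (aL C) (lindelof_degree X).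
Proof.
move=> cC; have [infL covL] := lindelof_degreeP.
set P := fun K : Type => infinite_set [set: K] /\
  forall V, open_cover C V -> exists W : set (set X),
    [/\ W `<=` V, W #<= [set: K] & C `<=` \bigcup_(U in W) closure U].
suff PL : P (lindelof_degree X).
  by have [_] := @least_cardinalP P (ex_intro _ _ PL); apply.
split=> // V [oV covV].
have [|W [WV WL covW]] := covL (V `|` [set ~` C]).
  split=> [U [/oV//|->]|x _]; first exact: closed_openC.
  have [/covV[U VU Ux]|nCx] := pselect (C x); first by exists U => //; left.
  by exists (~` C) => //; right.
exists (W `&` V); split=> //.
  by apply: card_le_trans WL; apply: subset_card_le => U [].
move=> x Cx; have [U WU Ux] := covW x I.
have [VU|UC] := WV _ WU; last by rewrite UC in Ux.
by exists U; [|apply: subset_closure].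
Qed.

Lemma aL_c_le_lindelof : cardinal_le (aL_c X) (lindelof_degree X).
Proof.
have [infL _] := lindelof_degreeP.
(* The Lindelöf degree is infinite, so it absorbs the summand [nat] of [aL_c]. *)
apply: cardinal_le_trans (cardinal_le_add_nat _ infL).
by apply: cardinal_le_add2r; apply: cardinal_sup_le; apply: aL_closed_le.
Qed.

End Lindelof.

Theorem corollary2p10 (X : topologicalType) (hX : hausdorff_space X) :
  [/\ cardinal_le (aL [set: X]) (aL' X),
      cardinal_le (aL' X) (aL_c X)
    & cardinal_le (aL_c X) (lindelof_degree X)].
Proof.
(* The minimum is attained at some section [b], which serves both inequalities about [aL']. *)
have [[b b_section /card_eqPle[_ aL_b_le]] aL'_le] :=
  cardinal_minP _ _ (@aL_b X) (exists_section X).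
split; last exact: aL_c_le_lindelof.
- exact: cardinal_le_trans (aL_le_aL_b _ _ b_section) aL_b_le.
- apply: cardinal_le_trans (aL_b_le_aL_c _ _ b_section).
  by apply: aL'_le; exists b => //; apply: card_eqxx.
Qed.
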